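(* Let $r,c,\ell$ be nonnegative integers with $\ell\le rc$. The stationary probability of $A\in S_{r\times c,\ell}$ for the several jugglers Markov chain described in the context is $$\pi(A)=\frac{1}{Z_{r\times c,\ell}}\prod_{i=1}^r\bigl(ci-A_{<i}\bigr)_{A_i},$$ where $A_i$ is the number of balls in row $i$ of $A$, $A_{<i}=A_1+\cdots+A_{i-1}$, $(x)_m=x(x-1)\cdots(x-m+1)$ denotes the falling factorial, and $Z_{r\times c,\ell}$ is the normalization factor.
   Context: $S_{r\times c}$ is the set of rectangular arrays with $r$ rows (numbered $1,\ldots,r$ from top to bottom) and $c$ columns in which each cell is either empty or contains one ball; $S_{r\times c,\ell}$ is the subset of arrays with exactly $\ell$ balls. For $A\in S_{r\times c}$, $A^-$ is obtained by removing all balls of the bottom row $r$ and moving every other ball down one row (so the top row of $A^-$ is empty). $A\subset B$ means every ball of $A$ is a ball of $B$ (same cell). The transition probability from $A$ to $B$ in $S_{r\times c,\ell}$ is $1/\binom{rc-\ell+A_r}{A_r}$ if $A^-\subset B$, and $0$ otherwise (the $A_r$ balls from the bottom row are reinjected uniformly into distinct empty cells of $A^-$). *)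

(* Defs.v *)
From HB Require Import structures.
From mathcomp Require Import all_boot all_order all_algebra.

Set Implicit Arguments.
Unset Strict Implicit.
Unset Printing Implicit Defensive.

Import Order.TTheory GRing.Theory Num.Theory.
Local Open Scope ring_scope.

Section FiniteMarkovChain.

Variables (R : realFieldType) (T : finType).

Definition is_distribution (p : T -> R) : Prop :=
  (forall x, 0 <= p x) /\ \sum_x p x = 1.

Definition is_stationary (P : T -> T -> R) (p : T -> R) : Prop :=
  is_distribution p /\ forall y, \sum_x p x * P x y = p y.

End FiniteMarkovChain.

Section SeveralJugglers.

Variables (r c : nat).

(* An array is the set of its occupied cells. The cell x lies in the row
   numbered x.1.+1, rows being numbered 1, ..., r from top to bottom. *)
Local Notation array := {set 'I_r * 'I_c}.

Definition arrayn (l : nat) : Type := {A : array | #|A| == l}.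

HB.instance Definition _ (l : nat) := SubFinite.on (arrayn l).

Implicit Types (A : array) (i : nat).

Definition row_balls A i : nat := #|[set x in A | x.1.+1 == i]|.

Definition row_balls_lt A i : nat := (\sum_(1 <= j < i) row_balls A j)%N.

Definition shift_down A : array :=
  [set x : 'I_r * 'I_c | [exists y in A, (x.1 == y.1.+1 :> nat) && (x.2 == y.2)]].

Definition transition (R : realFieldType) (l : nat) (A B : arrayn l) : R :=
  if shift_down (val A) \subset val B
  then ('C(r * c - l + row_balls (val A) r, row_balls (val A) r)%:R)^-1
  else 0.

(* The truncated subtraction is exact: the i - 1 rows above row i contain at
   most c * (i - 1) balls. *)
Definition weight A : nat :=
  (\prod_(1 <= i < r.+1) (c * i - row_balls_lt A i) ^_ (row_balls A i))%N.

Definition normalization (l : nat) : nat :=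
  (\sum_(A : arrayn l) weight (val A))%N.

Definition juggling_pi (R : realFieldType) (l : nat) (A : arrayn l) : R :=
  (normalization l)%:R^-1 * (weight (val A))%:R.

End SeveralJugglers.

(* Main.v *)
(* The weight of [A] counts the injections of the balls of [A] into cells that
   lie no lower than the ball. Sorting the injections of [B] by the set [C] of
   balls that are not sent to the top row gives
     weight B = \sum_(C \subset B) c ^_ #|B :\: C| * lag_weight 1 C,
   where [lag_weight 1 C] counts the injections sending each ball strictly
   upwards. An array [A] with [A^- = C] has weight
   [lag_weight 1 C * (r c - #|C|) ^_ m], with [m] balls in its bottom row, so it
   contributes [lag_weight 1 C * m`!] to the inflow at [B], and there are
   ['C(c, m)] such arrays: the inflow at [B] is [weight B].

   For uniqueness, the ratio of a stationary distribution to the positive one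
   attains its minimum, and its maximum, on a set closed under predecessors, and
   all arrays are reachable from the array filled greedily from the top. *)
Require Import Defs.
From HB Require Import structures.
From mathcomp Require Import all_boot all_order all_algebra.
From mathcomp Require Import zify.

Set Implicit Arguments.
Unset Strict Implicit.
Unset Printing Implicit Defensive.

Import Order.TTheory GRing.Theory Num.Theory.
Local Open Scope ring_scope.

(** * Uniqueness of stationary distributions of finite chains *)

Section MarkovUniqueness.

Variables (R : realFieldType) (T : finType) (P : T -> T -> R).
Hypothesis P_ge0 : forall x y, 0 <= P x y.

(** Edges point backwards in time, from a state to its possible predecessors. *)
Let pred_rel : rel T := [rel y x | 0 < P x y].

(** A vanishing sum of nonnegative terms has only zero terms, so a zero of [g] spreads to every
    predecessor. *)
Lemma invariant_zero_pred (g : T -> R) (y z : T) :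
    (forall x, 0 <= g x) -> (forall y, \sum_x g x * P x y = g y) ->
  connect pred_rel y z -> g y = 0 -> g z = 0.
Proof.
move=> g_ge0 gP /connectP[s + ->]; elim: s y => //= x s IHs y /andP[Pxy /IHs].
move=> IH gy0; apply: IH; apply/eqP.
have /eqP := gP y; rewrite gy0 psumr_eq0 => [/allP/(_ x (mem_index_enum _))|w _].
  by rewrite /= mulf_eq0 (gt_eqF Pxy) orbF.
exact: mulr_ge0.
Qed.

(* The minimum and the maximum of [p / q] propagate to predecessors, so both
   are attained at [s]. *)
Lemma stationary_unique (p q : T -> R) (s : T) :
    is_stationary P p -> is_stationary P q -> (forall x, 0 < q x) ->
    (forall y, connect pred_rel y s) -> p =1 q.
Proof.
move=> [[_ p1] pP] [[_ q1] qP] q_gt0 conn.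
pose f x := p x / q x.
have pE x : p x = f x * q x by rewrite divfK // gt_eqF.
have [u _ fu] := @arg_minP _ R T s predT f isT.
have [v _ fv] := @arg_maxP _ R T s predT f isT.
(* [p - t * q] is invariant for every [t]; for [t] an extreme ratio it has constant sign and a
   zero. *)
have lin t y : \sum_x (p x - t * q x) * P x y = p y - t * q y.
  rewrite -[in RHS]pP -[in RHS](qP y) mulr_sumr -sumrB.
  by apply: eq_bigr => x _; rewrite mulrBl mulrA.
have q_inj : injective (fun a => a * q s) by apply: mulIf; rewrite gt_eqF.
have fsu : f s = f u.
  apply/q_inj/eqP; rewrite /= -pE -subr_eq0; apply/eqP.
  apply: (@invariant_zero_pred (fun x => p x - f u * q x) _ _ _ (lin _) (conn u)).
    by move=> x; rewrite [X in X - _]pE subr_ge0 ler_pM2r //; apply: fu.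
  by rewrite pE subrr.
have fsv : f s = f v.
  apply/q_inj/esym/eqP; rewrite /= -pE -subr_eq0; apply/eqP.
  apply: (@invariant_zero_pred (fun x => f v * q x - p x) _ _ _ _ (conn v)).
  - by move=> x; rewrite [X in _ - X]pE subr_ge0 ler_pM2r //; apply: fv.
  - move=> y; rewrite -[RHS]opprB -lin -sumrN.
    by apply: eq_bigr => x _; rewrite -mulNr opprB.
  - by rewrite [X in _ - X]pE subrr.
have fE x : f x = f s.
  by apply/eqP; rewrite eq_le {1}fsv fsu fu // andbT; apply: fv.
have fs1 : f s = 1.
  rewrite -p1; under eq_bigr => x _ do rewrite pE fE.
  by rewrite -mulr_sumr q1 mulr1.
by move=> x; rewrite pE fE fs1 mul1r.
Qed.

End MarkovUniqueness.

(** * Finite subsets *)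

Lemma exists_subset_card (T : finType) (A : {set T}) (n : nat) :
  (n <= #|A|)%N -> exists2 B : {set T}, B \subset A & #|B| = n.
Proof.
move=> lenA; have: (0 < #|[set B : {set T} | (B \subset A) && (#|B| == n)]|)%N.
  by rewrite cards_draws bin_gt0.
by case/card_gt0P=> B; rewrite inE => /andP[sBA /eqP]; exists B.
Qed.

(** The subsets containing [b] are the [b |: C]. This drives the one-ball induction in
    [weight_decomposition]. *)
Lemma sum_subset_setD1 (T : finType) (B : {set T}) (b : T) (F : {set T} -> nat) :
    b \in B ->
  (\sum_(C : {set T} | C \subset B) F C =
   \sum_(C : {set T} | C \subset B :\ b) (F (b |: C) + F C))%N.
Proof.
move=> bB; rewrite big_split /= (bigID (fun C : {set T} => b \in C)) /=.
congr (_ + _)%N; last by apply: eq_bigl => C; rewrite subsetD1.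
rewrite (reindex_onto (fun C => b |: C) (fun C => C :\ b)) /=; last first.
  by move=> C /andP[_ bC]; rewrite setD1K.
apply: eq_bigl => C; rewrite setU11 andbT subUset sub1set bB /= subsetD1.
congr andb; apply/eqP/idP => [<-|bC]; first by rewrite setD11.
by rewrite setU1K.
Qed.

(** * Weights as counts of injections *)

Section Weights.

Variables (r c : nat).

Local Notation cell := ('I_r * 'I_c)%type.
Implicit Types (A B C : {set cell}) (b x : cell).

(** Rows are numbered from 1 while [x.1] starts at 0, hence the bound [i] for [i.+1]. *)
Lemma row_balls_ltS A i : row_balls_lt A i.+1 = #|[set x in A | x.1 < i]%N|.
Proof.
rewrite /row_balls_lt; elim: i => [|i IHi].
  by rewrite big_geq // eq_card0 // => x; rewrite !inE ltn0 andbF.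
rewrite big_nat_recr //= IHi /row_balls -cardsUI.
have /eqP : [set x in A | x.1 < i]%N :&: [set x in A | x.1.+1 == i.+1] = set0.
  by apply/setP=> x; rewrite !inE; case: (x \in A) => //=; lia.
rewrite -cards_eq0 => /eqP->; rewrite addn0.
by apply: eq_card => x; rewrite !inE -andb_orr eqSS ltnS [in RHS]leq_eqVlt orbC.
Qed.

Lemma row_balls_le A i : (row_balls A i <= c)%N.
Proof.
rewrite -[leqRHS]card_ord /row_balls -(@card_in_imset _ _ snd) ?max_card //.
move=> [x1 x2] [y1 y2]; rewrite !inE /= => /andP[_ /eqP e1] /andP[_ /eqP e2] ->.
by congr pair; apply: val_inj; apply: succn_inj; rewrite /= e1.
Qed.

Lemma row_balls_lt_le A i : (row_balls_lt A i.+1 <= c * i)%N.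
Proof.
rewrite /row_balls_lt (leq_trans (leq_sum _ (fun j _ => row_balls_le A j))) //.
by rewrite sum_nat_const_nat subn1 mulnC.
Qed.

(** Rows 1 to [i] hold at most [c * i] balls, so no falling factorial is longer than its base. *)
Lemma weight_gt0 A : (0 < weight A)%N.
Proof.
rewrite /weight big_nat prodn_cond_gt0 // => -[//|i _]; rewrite ffact_gt0.
have := row_balls_lt_le A i.+1; rewrite /row_balls_lt big_nat_recr //= addnC.
lia.
Qed.

(* [lag_weight 1 C] counts the injections of the balls of [C] into cells that
   lie in strictly higher rows. *)
Definition lag_weight (d : nat) C : nat :=
  (\prod_(1 <= i < r.+1) (c * (i - d) - row_balls_lt C i) ^_ (row_balls C i))%N.

Lemma lag_weight0 A : lag_weight 0 A = weight A.
Proof. by apply: eq_bigr => i _; rewrite subn0. Qed.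

Lemma row_balls_setD1 C b i :
  b \in C -> row_balls C i = ((b.1.+1 == i) + row_balls (C :\ b) i)%N.
Proof.
move=> bC; rewrite /row_balls (cardsD1 b) inE bC /=; congr (_ + _)%N.
by apply: eq_card => x; rewrite !inE andbA.
Qed.

(** Place a lowest ball [b] last: of the [c * (b.1.+1 - d)] cells open to it, the other balls occupy
    [#|C :\ b|]. This is the last factor of the falling factorial of its row. *)
Lemma lag_weight_setD1 d C b : b \in C -> (forall x, x \in C -> x.1 <= b.1)%N ->
  lag_weight d C = (lag_weight d (C :\ b) * (c * (b.1.+1 - d) - #|C :\ b|))%N.
Proof.
move=> bC bmax; rewrite /lag_weight.
have bI : b.1.+1 \in index_iota 1 r.+1 by rewrite mem_index_iota /= ltnS ltn_ord.
rewrite !(bigD1_seq b.1.+1) ?iota_uniq //= mulnAC; congr (_ * _)%N; last first.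
  rewrite big_nat_cond [in RHS]big_nat_cond; apply: eq_bigr => i /andP[/andP[i1 ir] nib].
  have [ltib|leib] := ltnP i b.1.+1.
    rewrite (row_balls_setD1 _ bC) eq_sym (negbTE nib); congr ((_ - _) ^_ _)%N.
    rewrite /row_balls_lt big_nat [in RHS]big_nat; apply: eq_bigr => j /andP[_ ji].
    by rewrite (row_balls_setD1 _ bC); case: eqP => //; lia.
  (* Rows below [b] are empty, so their factors are 1. *)
  have z (D : {set cell}) : D \subset C -> row_balls D i = 0%N.
    move=> /subsetP sDC; apply: eq_card0 => x.
    rewrite !inE; apply/negP=> /andP[/sDC/bmax xb /eqP xi]; move: leib.
    rewrite -xi ltnS leqNgt ltn_neqAle xb andbT negbK => /eqP bx.
    by rewrite -xi -bx eqxx in nib.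
  by rewrite !z ?subD1set.
rewrite (row_balls_setD1 _ bC) eqxx add1n ffactnSr.
have -> : row_balls_lt C b.1.+1 = row_balls_lt (C :\ b) b.1.+1.
  rewrite !row_balls_ltS; apply: eq_card => x; rewrite !inE.
  by have [->|] := eqVneq x b => //=; rewrite ltnn andbF.
congr (_ * _)%N; rewrite -subnDA; congr subn.
have <- : row_balls_lt (C :\ b) b.1.+2 = #|C :\ b|.
  rewrite row_balls_ltS; apply: eq_card => x; rewrite !inE ltnS.
  by case xC: (x \in C); rewrite ?andbF //= bmax ?andbT.
by rewrite /row_balls_lt [in RHS]big_nat_recr.
Qed.

Lemma max_row_exists A :
  A != set0 -> exists2 b, b \in A & forall x, x \in A -> (x.1 <= b.1)%N.
Proof.
case/set0Pn=> a aA; have [b bA bmax] := arg_maxnP (fun x : cell => x.1 : nat) aA.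
by exists b.
Qed.

(** The factor of a lowest ball is positive, so the other balls leave it a free cell. *)
Lemma lag_weight_gt0_card d C i :
    (forall x, x \in C -> x.1 <= i)%N -> (0 < lag_weight d C)%N ->
  (#|C| <= c * (i.+1 - d))%N.
Proof.
move=> Ci; have [->|/max_row_exists[b bC bmax]] := eqVneq C set0.
  by rewrite cards0.
rewrite (lag_weight_setD1 _ bC bmax) muln_gt0 subn_gt0 => /andP[_].
rewrite (cardsD1 b C) bC => /leq_trans; apply.
by rewrite leq_mul // leq_sub2r // ltnS Ci.
Qed.

(* Split the injections counted by [weight B] according to the set [B :\: C] of
   balls that are sent to the top row. *)
Lemma weight_decomposition B :
  weight B = (\sum_(C : {set cell} | C \subset B) c ^_ #|B :\: C| * lag_weight 1 C)%N.
Proof.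
rewrite -lag_weight0; have [n] := ubnP #|B|; elim: n B => // n IHn B.
have [-> _|/max_row_exists[b bB bmax]] := eqVneq B set0.
  rewrite (big_pred1 set0) => [|C]; last by rewrite subset0.
  rewrite setD0 cards0 mul1n; apply: eq_bigr => i _.
  by rewrite /row_balls eq_card0 // => x; rewrite !inE.
rewrite (cardsD1 b B) bB add1n ltnS => cB.
rewrite (lag_weight_setD1 _ bB bmax) subn0 IHn // (sum_subset_setD1 _ bB) big_distrl /=.
apply: eq_bigr => C; rewrite subsetD1 => /andP[sCB bC].
have -> : B :\: (b |: C) = (B :\ b) :\: C by rewrite setDDl.
have cBC : #|B :\: C| = #|(B :\ b) :\: C|.+1.
  by rewrite (cardsD1 b) !inE bC bB /= add1n !setDDl setUC.
rewrite (@lag_weight_setD1 _ (b |: C) b) ?setU11 //; last first.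
  by move=> x /setU1P[->//|/(subsetP sCB)/bmax].
rewrite setU1K // cBC ffactnSr subn1 /=.
have cE : #|B :\ b| = (#|C| + #|(B :\ b) :\: C|)%N.
  rewrite -(cardsID C (B :\ b)); congr addn; apply: eq_card => x; rewrite !inE.
  have [->|_] := eqVneq x b; first by rewrite (negbTE bC).
  by case xC: (x \in C); rewrite ?andbF // (subsetP sCB).
set m := #|(B :\ b) :\: C| in cE *.
(* If [lag_weight 1 C] or [c ^_ m] is zero, both sides vanish. Otherwise [#|C| <= c * b.1] and
   [m <= c], so the free cells for [b] split exactly into [c - m] in the top row and
   [c * b.1 - #|C|] below it. *)
have [/eqP w0|w_gt0] := posnP (lag_weight 1 C).
  by rewrite (eqP w0) !(muln0, mul0n).
have [->|] := posnP (c ^_ m); first by rewrite !mul0n.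
rewrite ffact_gt0 => le_mc.
have leC : (#|C| <= c * b.1)%N.
  rewrite -[X in (c * X)%N]/(b.1.+1.-1) -subn1.
  by apply: (lag_weight_gt0_card (i := b.1)) w_gt0 => x /(subsetP sCB)/bmax.
have -> : (c * b.1.+1 - #|B :\ b| = (c * b.1 - #|C|) + (c - m))%N.
  by rewrite cE mulnS; lia.
by rewrite mulnDr -!mulnA [((c - m) * _)%N]mulnC.
Qed.

End Weights.

Lemma transition_ge0 (R : realFieldType) (r c l : nat) (A B : arrayn r c l) :
  0 <= transition R A B.
Proof. by rewrite /transition; case: ifP; rewrite // invr_ge0. Qed.

Lemma transition_gt0 (R : realFieldType) (r c l : nat) (A B : arrayn r c l) :
  shift_down (val A) \subset val B -> 0 < transition R A B.
Proof. by rewrite /transition => ->; rewrite invr_gt0 ltr0n bin_gt0 leq_addl. Qed.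

(** * Shifting arrays, and stationarity of the weights *)

Section Shift.

Variables (n c : nat).

Local Notation cell := ('I_n.+1 * 'I_c)%type.
Implicit Types (A B C E : {set cell}) (x y : cell).

(** At the edges, [cell_up] fixes the top row, and [cell_down] sends the bottom row to the top one,
    the default of [inord]. The bounds on [x.1] below exclude these cases. *)
Definition cell_up x : cell := (inord x.1.-1, x.2).
Definition cell_down x : cell := (inord x.1.+1, x.2).

Lemma cell_up_row x : (cell_up x).1 = x.1.-1 :> nat.
Proof. by rewrite inordK // (leq_ltn_trans (leq_pred _)). Qed.

Lemma cell_down_row x : (x.1 < n)%N -> (cell_down x).1 = x.1.+1 :> nat.
Proof. by move=> xn; rewrite inordK. Qed.

Lemma cell_eq x y : x.1 = y.1 :> nat -> x.2 = y.2 -> x = y.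
Proof. by case: x y => [x1 x2] [y1 y2] /= /val_inj -> ->. Qed.

Lemma cell_upK x : (0 < x.1)%N -> cell_down (cell_up x) = x.
Proof.
move=> x_gt0; apply: cell_eq => //; rewrite cell_down_row cell_up_row.
  by rewrite prednK.
by rewrite -ltnS prednK.
Qed.

Lemma cell_downK x : (x.1 < n)%N -> cell_up (cell_down x) = x.
Proof. by move=> xn; apply: cell_eq => //; rewrite cell_up_row cell_down_row. Qed.

Lemma in_shift_down A x :
  (x \in shift_down A) = (0 < x.1)%N && (cell_up x \in A).
Proof.
rewrite inE; apply/exists_inP/andP => [[y yA /andP[/eqP xy /eqP xy2]]|[x_gt0 xA]].
  split; first by rewrite xy.
  by rewrite (_ : cell_up x = y) //; apply: cell_eq; rewrite ?cell_up_row ?xy.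
by exists (cell_up x); rewrite // cell_up_row prednK ?eqxx.
Qed.

Definition bottom_row : {set cell} := [set x : cell | x.1 == n :> nat].

Lemma notin_bottom_row x : (x \notin bottom_row) = (x.1 < n)%N.
Proof. by rewrite inE ltn_neqAle -ltnS ltn_ord andbT. Qed.

Lemma card_bottom_row : #|bottom_row| = c.
Proof.
have inj : injective (fun j : 'I_c => (ord_max, j) : cell) by move=> j k [].
rewrite -[RHS]card_ord -(card_imset _ inj); apply: eq_card => x; rewrite !inE.
apply/eqP/imsetP => [xn|[j _ ->]//]; exists x.2 => //; exact: cell_eq.
Qed.

Lemma shift_down_imset A : shift_down A = cell_down @: (A :\: bottom_row).
Proof.
apply/setP=> x; rewrite in_shift_down.
apply/andP/imsetP => [[x_gt0 xA]|[y]].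
  exists (cell_up x); rewrite ?cell_upK // !inE xA andbT cell_up_row.
  by rewrite neq_ltn -ltnS prednK ?ltn_ord.
rewrite in_setD notin_bottom_row => /andP[yn yA] ->.
by rewrite cell_downK // cell_down_row.
Qed.

Lemma cell_down_inj A : {in A :\: bottom_row &, injective cell_down}.
Proof.
move=> x y; rewrite !in_setD !notin_bottom_row => /andP[xn _] /andP[yn _] e.
by rewrite -[x]cell_downK // e cell_downK.
Qed.

Lemma card_shift_down A : #|shift_down A| = #|A :\: bottom_row|.
Proof. by rewrite shift_down_imset card_in_imset //; apply: cell_down_inj. Qed.

Lemma row_balls_bottom A : row_balls A n.+1 = #|A :&: bottom_row|.
Proof. by apply: eq_card => x; rewrite !inE eqSS. Qed.

Lemma row_balls_shift_down1 A : row_balls (shift_down A) 1 = 0%N.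
Proof.
apply: eq_card0 => x; rewrite inE in_shift_down eqSS lt0n.
by case: eqP; rewrite ?andbF.
Qed.

Lemma row_balls_shift_down A i :
  (i <= n)%N -> row_balls (shift_down A) i.+1 = row_balls A i.
Proof.
case: i => [_|i ltin].
  by rewrite row_balls_shift_down1; apply/esym/eq_card0 => x; rewrite inE andbF.
rewrite [in RHS]/row_balls -(@card_in_imset _ _ cell_down).
  apply: eq_card => x; rewrite inE in_shift_down.
  apply/andP/imsetP => [[/andP[x_gt0 xA] /eqP xi]|[y]].
    exists (cell_up x); rewrite ?cell_upK // inE xA cell_up_row prednK //.
    by rewrite -eqSS xi eqxx.
  rewrite inE => /andP[yA /eqP yi ->]; have yn : (y.1 < n)%N by rewrite yi.
  by rewrite cell_downK // cell_down_row // yi.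
move=> x y; rewrite !inE => /andP[xA /eqP xi] /andP[yA /eqP yi].
by apply: (@cell_down_inj setT); rewrite in_setD notin_bottom_row ?xi ?yi ltin inE.
Qed.

Lemma row_balls_lt_shift_down A i :
  (i <= n.+1)%N -> row_balls_lt (shift_down A) i.+1 = row_balls_lt A i.
Proof.
case: i => [_|i lein]; first by rewrite /row_balls_lt !big_geq.
rewrite /row_balls_lt big_nat_recl // row_balls_shift_down1 add0n.
rewrite big_nat [in RHS]big_nat; apply: eq_bigr => j /andP[_ ji].
by rewrite row_balls_shift_down // -ltnS (leq_trans ji).
Qed.

(** Lowering the balls turns the factor of row [i] into that of row [i.+1] with lag 1. The bottom
    row gives the other falling factorial, as [#|shift_down A|] balls lie above it. *)
Lemma weight_shift_down A :
  weight A = (lag_weight 1 (shift_down A) *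
    (c * n.+1 - #|shift_down A|) ^_ (row_balls A n.+1))%N.
Proof.
rewrite /weight /lag_weight big_nat_recr // [in RHS]big_nat_recl //=.
rewrite row_balls_shift_down1 ffactn0 mul1n; congr (_ * _)%N.
  rewrite big_nat [in RHS]big_nat; apply: eq_bigr => i /andP[_ ltin].
  by rewrite subn1 row_balls_lt_shift_down ?row_balls_shift_down // ltnW.
rewrite row_balls_ltS card_shift_down; congr ((_ - _) ^_ _)%N.
by apply: eq_card => x; rewrite !inE -notin_bottom_row inE andbC.
Qed.

Definition shift_up C : {set cell} := cell_up @: C.

Lemma in_shift_up C x : (forall y, y \in C -> 0 < y.1)%N ->
  (x \in shift_up C) = (x.1 < n)%N && (cell_down x \in C).
Proof.
move=> C_gt0; apply/imsetP/andP => [[y yC ->]|[xn xC]].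
  by rewrite cell_upK ?C_gt0 // cell_up_row -ltnS prednK ?C_gt0.
by exists (cell_down x); rewrite ?cell_downK.
Qed.

Lemma card_shift_up C : (forall y, y \in C -> 0 < y.1)%N -> #|shift_up C| = #|C|.
Proof.
move=> C_gt0; rewrite card_in_imset // => x y xC yC e.
by rewrite -(cell_upK (C_gt0 x xC)) e cell_upK // C_gt0.
Qed.

Lemma shift_upU_disjoint C E : (forall y, y \in C -> 0 < y.1)%N ->
  E \subset bottom_row -> shift_up C :&: E = set0.
Proof.
move=> C_gt0 /subsetP sE; apply/setP=> x; rewrite in_setI in_shift_up // in_set0.
by apply/negP=> /andP[/andP[xn _] /sE]; apply/negP; rewrite notin_bottom_row.
Qed.

Lemma card_shift_upU C E : (forall y, y \in C -> 0 < y.1)%N ->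
  E \subset bottom_row -> #|shift_up C :|: E| = (#|C| + #|E|)%N.
Proof.
by move=> C0 sE; rewrite cardsU shift_upU_disjoint // cards0 subn0 card_shift_up.
Qed.

(** With [shift_downK], this identifies an array with the pair of its shift, whose top row is empty,
    and its set of bottom balls. *)
Lemma shift_down_upU C E : (forall y, y \in C -> 0 < y.1)%N ->
  E \subset bottom_row -> shift_down (shift_up C :|: E) = C.
Proof.
move=> C_gt0 /subsetP sE; apply/setP=> x; rewrite in_shift_down in_setU in_shift_up //.
have [x_gt0|] := posnP x.1; last first.
  move=> x_gt0; rewrite cell_upK // cell_up_row -ltnS prednK // ltn_ord /=.
  have [//|xC] := boolP (x \in C); apply/negP=> /sE.
  by apply/negP; rewrite notin_bottom_row cell_up_row -ltnS prednK.
by apply/esym/negP=> /C_gt0; rewrite x_gt0.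
Qed.

Lemma shift_downK A : shift_up (shift_down A) :|: (A :&: bottom_row) = A.
Proof.
apply/setP=> x; rewrite in_setU in_shift_up => [|y]; last first.
  by rewrite in_shift_down => /andP[].
rewrite in_shift_down in_setI; have [xb|] := boolP (x \in bottom_row).
  move: xb; rewrite andbT inE => /eqP->; by rewrite ltnn.
by rewrite notin_bottom_row => xn; rewrite xn cell_downK // cell_down_row //= andbF orbF.
Qed.

(** A preimage of [C] is determined by its bottom row, an arbitrary choice of [k] cells among
    [c]. *)
Lemma card_shift_down_fiber C k : (forall y, y \in C -> 0 < y.1)%N ->
  #|[set A : {set cell} | (#|A| == #|C| + k)%N && (shift_down A == C)]| = 'C(c, k).
Proof.
move=> C_gt0; rewrite -[in RHS]card_bottom_row -cards_draws.
rewrite -[in RHS](@card_in_imset _ _ (fun E => shift_up C :|: E)) => [|E E']; last first.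
  rewrite !inE => /andP[sE _] /andP[sE' _] eE.
  suff bE (F : {set cell}) : F \subset bottom_row -> (shift_up C :|: F) :&: bottom_row = F.
    by rewrite -[E]bE // eE bE.
  by move=> sF; rewrite setIUl shift_upU_disjoint // set0U; apply/setIidPl.
apply: eq_card => A; rewrite inE.
apply/andP/imsetP => [[/eqP cA /eqP sA]|[E]].
  exists (A :&: bottom_row); last by rewrite -sA shift_downK.
  rewrite inE subsetIr /=; move: cA; rewrite -(cardsID bottom_row A) -sA card_shift_down.
  by rewrite addnC => /addnI ->.
by rewrite inE => /andP[sE /eqP cE ->]; rewrite card_shift_upU // shift_down_upU // cE !eqxx.
Qed.

(** Lag 1 leaves no cell for a top-row ball. Such a [C] is never a shift, and its term in the
    decomposition must vanish. *)
Lemma lag_weight1_top C y : y \in C -> y.1 = 0%N :> nat -> lag_weight 1 C = 0%N.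
Proof.
move=> yC y0; rewrite /lag_weight big_nat_recl // subnn muln0 sub0n.
suff : (0 < row_balls C 1)%N by case: (row_balls C 1).
by apply/card_gt0P; exists y; rewrite inE yC y0.
Qed.

Lemma row_balls_bottom_shift A :
  row_balls A n.+1 = (#|A| - #|shift_down A|)%N.
Proof.
by rewrite row_balls_bottom card_shift_down -(cardsID bottom_row A) addnK.
Qed.

Lemma card_arrayn_fiber l C : (forall y, y \in C -> 0 < y.1)%N -> (#|C| <= l)%N ->
  #|[set A : arrayn n.+1 c l | shift_down (val A) == C]| = 'C(c, l - #|C|).
Proof.
move=> C_gt0 leCl; rewrite -(card_shift_down_fiber _ C_gt0) subnKC //.
rewrite -(card_imset _ val_inj); apply: eq_card => A; rewrite [in RHS]inE.
apply/imsetP/andP => [[A']|[cA sA]].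
  by rewrite inE => sA ->; split=> //; apply: (valP A').
by exists (Sub A cA); rewrite ?inE SubK.
Qed.

Lemma weight_stationary (R : realFieldType) l (B : arrayn n.+1 c l) :
    (l <= n.+1 * c)%N ->
  \sum_(A : arrayn n.+1 c l) (weight (val A))%:R * transition R A B =
  (weight (val B))%:R.
Proof.
move=> le_l; rewrite weight_decomposition.
rewrite (bigID (fun A : arrayn n.+1 c l => shift_down (val A) \subset val B)) /=.
rewrite [X in _ + X]big1 ?addr0 => [|A /negbTE sAB]; last first.
  by rewrite /transition sAB mulr0.
(* Each class of arrays with the same shift [C] is compared with the term of [C] in the
   decomposition. *)
rewrite (partition_big (fun A : arrayn n.+1 c l => shift_down (val A))
  (fun C => C \subset val B)) //= natr_sum; apply: eq_bigr => C sCB.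
have cB : #|val B| = l by apply/eqP/(valP B).
have leCl : (#|C| <= l)%N by rewrite -cB subset_leq_card.
have cBC : #|val B :\: C| = (l - #|C|)%N by rewrite cardsD (setIidPr sCB) cB.
transitivity (\sum_(A in [set A : arrayn n.+1 c l | shift_down (val A) == C])
    (lag_weight 1 C * (l - #|C|)`!)%:R : R).
  apply: eq_big => [A|A /andP[sAB /eqP sAC]].
    by rewrite inE andb_idl // => /eqP->.
  rewrite /transition sAB weight_shift_down row_balls_bottom_shift sAC (eqP (valP A)).
  (* By [le_l] the truncated subtraction is exact. The binomial and the falling factorial then share
     their base, and their quotient is a factorial. *)
  have -> : (n.+1 * c - l + (l - #|C|) = c * n.+1 - #|C|)%N.
    by rewrite mulnC; move: (mulnC c n.+1) => e; lia.
  rewrite -bin_ffact mulnA mulnAC natrM mulfK // pnatr_eq0 -lt0n bin_gt0.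
  by apply: leq_sub2r; rewrite mulnC.
rewrite sumr_const -[LHS]mulr_natr -natrM; congr _%:R.
have [y /andP[yC /eqP y0]|noy] := pickP (fun y : cell => (y \in C) && (y.1 == 0%N :> nat)).
  by rewrite (lag_weight1_top yC y0) muln0 !mul0n.
rewrite card_arrayn_fiber // => [|y yC]; last first.
  by rewrite lt0n; move: (noy y); rewrite yC /= => ->.
by rewrite cBC -bin_ffact -mulnA mulnC [(_`! * _)%N]mulnC.
Qed.

End Shift.

(** * Reachability from the greedily filled array *)

Section Reachability.

Variables (n c : nat).

Local Notation cell := ('I_n.+1 * 'I_c)%type.
Implicit Types (S X D E : {set cell}) (x y : cell).

(** Such an array consists of full rows, then one arbitrary row, then empty rows. *)
Definition top_packed S := forall x y, x \in S -> (y.1 < x.1)%N -> y \in S.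

Lemma top_packed_exists l : (l <= n.+1 * c)%N ->
  exists2 S : {set cell}, #|S| = l & top_packed S.
Proof.
elim: l => [_|l IHl ltl].
  by exists set0; rewrite ?cards0 // => x y; rewrite inE.
have [S cS pS] := IHl (ltnW ltl).
have : (0 < #|~: S|)%N by rewrite cardsCs setCK cS card_prod !card_ord subn_gt0.
case/card_gt0P=> a aS.
(* The new ball goes to a highest empty cell, so all rows above it are full. *)
have [b bS bmin] := arg_minnP (fun x : cell => x.1 : nat) aS.
exists (b |: S).
  have bS' : b \notin S by rewrite -in_setC.
  by rewrite cardsU1 cS bS'.
move=> x y /setU1P[->|xS] yx; rewrite in_setU1; last by rewrite (pS x) ?orbT.
have [yS|yS] := boolP (y \in S); first by rewrite orbT.
have yS' : y \in ~: S by rewrite inE.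
by have := bmin y yS'; rewrite leqNgt yx.
Qed.

(* The bottom [k] rows of [X] are the top [k] rows of [S]. *)
Definition matches k X S := forall x y,
  x.1 = (y.1 + (n.+1 - k))%N :> nat -> x.2 = y.2 -> (x \in X) = (y \in S).

Lemma matches0 X S : matches 0 X S.
Proof. by move=> x y xy; have := ltn_ord x.1; rewrite xy subn0 ltnNge leq_addl. Qed.

Lemma matches_full X S : matches n.+1 X S -> X = S.
Proof. by move=> m; apply/setP=> x; apply: m; rewrite ?subnn ?addn0. Qed.

Lemma set_row_inj (i : 'I_n.+1) (j : nat) (A : {set cell}) :
  (forall x, x \in A -> x.1 = j :> nat) ->
  {in A &, injective (fun x => (i, x.2) : cell)}.
Proof.
by move=> Aj x y xA yA [exy]; apply: cell_eq; rewrite ?(Aj x) ?(Aj y).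
Qed.

(** The matched parts correspond under a vertical shift, so the unmatched parts have equal sizes
    too. *)
Lemma matches_rest_card k X S : (k <= n)%N -> #|X| = #|S| -> matches k X S ->
  #|[set x in X | x.1 < n.+1 - k]%N| = #|[set y in S | k <= y.1]%N|.
Proof.
move=> lekn cXS m.
have cX := cardsID [set x : cell | x.1 < n.+1 - k]%N X.
have cS := cardsID [set y : cell | k <= y.1]%N S.
pose h y : cell := (inord (y.1 + (n.+1 - k)), y.2).
have hE y : (y.1 < k)%N -> (h y).1 = (y.1 + (n.+1 - k))%N :> nat.
  by move=> yk; rewrite inordK //; lia.
have e : #|X :\: [set x : cell | x.1 < n.+1 - k]%N| =
         #|S :\: [set y : cell | k <= y.1]%N|.
  rewrite -[in RHS](@card_in_imset _ _ h) => [|y y']; last first.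
    rewrite !inE -!ltnNge => /andP[yk _] /andP[yk' _] ehy.
    apply: cell_eq; last by case: ehy.
    by apply/eqP; rewrite -(eqn_add2r (n.+1 - k)) -!hE // ehy.
  apply: eq_card => x; rewrite !inE -leqNgt.
  apply/andP/imsetP => [[lex xX]|[y]].
    have xy : (inord (x.1 - (n.+1 - k)) : 'I_n.+1) = (x.1 - (n.+1 - k))%N :> nat.
      by rewrite inordK // (leq_ltn_trans (leq_subr _ _)).
    have xk : (x.1 - (n.+1 - k) < k)%N by rewrite ltn_subLR // subnK ?ltn_ord // ltnW.
    exists (inord (x.1 - (n.+1 - k)), x.2).
      by rewrite !inE -ltnNge -(m x) //= xy ?xk ?xX ?subnK.
    by apply: cell_eq => //; rewrite hE /= xy ?subnK.
  rewrite !inE -ltnNge => /andP[yk yS] ->.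
  by rewrite hE // leq_addl (m _ y) // hE.
have -> : [set x in X | x.1 < n.+1 - k]%N = X :&: [set x : cell | x.1 < n.+1 - k]%N.
  by apply/setP=> x; rewrite !inE.
have -> : [set y in S | k <= y.1]%N = S :&: [set y : cell | k <= y.1]%N.
  by apply/setP=> x; rewrite !inE.
by apply/eqP; rewrite -(eqn_add2r #|X :\: [set x : cell | x.1 < n.+1 - k]%N|) cX e cS cXS.
Qed.

(** If [S] has a ball below its row of index [k], that row is full. Otherwise the balls of that row
    are as numerous as the unmatched balls of [X], which include its top row. *)
Lemma matches_top_card k X S :
    (k <= n)%N -> #|X| = #|S| -> top_packed S -> matches k X S ->
  (#|[set x in X | x.1 == 0%N :> nat]| <= #|[set y in S | y.1 == k :> nat]|)%N.
Proof.
move=> lekn cXS pS m.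
have [x /andP[xS kx]|nox] := pickP (fun x : cell => (x \in S) && (k < x.1)%N).
  have kE : (inord k : 'I_n.+1) = k :> nat by rewrite inordK.
  rewrite -(@card_in_imset _ _ (fun x => (inord k, x.2) : cell)); last first.
    by apply: (@set_row_inj _ 0) => y; rewrite inE => /andP[_ /eqP].
  apply/subset_leq_card/subsetP=> _ /imsetP[y _ ->].
  by rewrite inE /= kE eqxx andbT (pS x) //= kE.
have -> : [set y in S | y.1 == k :> nat] = [set y in S | k <= y.1]%N.
  apply/setP=> y; rewrite !inE; have := nox y; case: (y \in S) => //=.
  by move=> kyF; rewrite eq_sym leq_eqVlt kyF orbF.
rewrite -(matches_rest_card lekn cXS m); apply/subset_leq_card/subsetP=> x.
by rewrite !inE => /andP[-> /eqP->]; rewrite subn_gt0 ltnS.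
Qed.

(* The row inserted at the bottom must absorb the top row of [X], which has no
   predecessor position; this is possible as the rows of [S] are greedy. *)
Lemma matches_pred k X S :
    (k <= n)%N -> #|X| = #|S| -> top_packed S -> matches k X S ->
  exists X' : {set cell},
    [/\ #|X'| = #|S|, shift_down X' \subset X & matches k.+1 X' S].
Proof.
move=> lekn cXS pS m.
set Top := [set x in X | x.1 == 0%N :> nat].
set Rest := [set x in X | x.1 < n.+1 - k]%N.
set Sk := [set y in S | y.1 == k :> nat].
have leTS : (#|Top| <= #|Sk|)%N by apply: matches_top_card.
have leSR : (#|Sk| <= #|Rest|)%N.
  rewrite (matches_rest_card lekn cXS m); apply/subset_leq_card/subsetP=> y.
  by rewrite !inE => /andP[-> /eqP->] /=.
have sTR : Top \subset Rest.
  apply/subsetP=> x; rewrite !inE => /andP[-> /eqP->].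
  by rewrite subn_gt0 ltnS.
(* The balls [D] of [X] regarded as reinjected are its top row, padded by unmatched balls [F] up to
   the size of the row of [S] to be copied. *)
have [F sF cF] : exists2 F : {set cell}, F \subset Rest :\: Top &
    #|F| = (#|Sk| - #|Top|)%N.
  by apply: exists_subset_card; rewrite cardsD (setIidPr sTR) leq_sub2r.
have [D [sTD sDR cD]] : exists D : {set cell},
    [/\ Top \subset D, D \subset Rest & #|D| = #|Sk|].
  exists (Top :|: F); split; first exact: subsetUl.
    by rewrite subUset sTR (subset_trans sF) ?subsetDl.
  rewrite cardsU cF (_ : Top :&: F = set0) ?cards0 ?subn0 ?subnKC //.
  apply/setP=> x; rewrite in_set0 in_setI; apply/negP=> /andP[xT /(subsetP sF)].
  by rewrite in_setD xT.
have sDX : D \subset X.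
  by apply: (subset_trans sDR); apply/subsetP=> x; rewrite inE => /andP[].
pose C := X :\: D.
have C_gt0 y : y \in C -> (0 < y.1)%N.
  rewrite in_setD lt0n => /andP[yD yX]; apply: contraNN yD => y0.
  by apply: (subsetP sTD); rewrite inE yX y0.
(* The new bottom row copies the row of index [k] of [S]. *)
pose E : {set cell} := [set (ord_max, y.2) | y in Sk].
have cE : #|E| = #|Sk|.
  rewrite card_in_imset //; apply: (@set_row_inj _ k) => y.
  by rewrite inE => /andP[_ /eqP].
have sE : E \subset bottom_row n c.
  by apply/subsetP=> _ /imsetP[y _ ->]; rewrite inE.
exists (shift_up C :|: E); split.
- by rewrite card_shift_upU // cE cardsD (setIidPr sDX) cD subnK // -cD subset_leq_card.
- by rewrite shift_down_upU // subsetDl.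
move=> x y; rewrite subSS => xy xy2; rewrite in_setU in_shift_up //.
have [xn|xn] := ltnP x.1 n; rewrite /=.
  have -> : x \in E = false.
    by apply: contraTF xn => /(subsetP sE); rewrite inE -leqNgt => /eqP->.
  have dx : (cell_down x).1 = (y.1 + (n.+1 - k))%N :> nat.
    by rewrite cell_down_row // xy subSn // addnS.
  (* Balls of [D] lie above the rows already matched, so removing them keeps the match. *)
  rewrite orbF in_setD (m _ y) // andb_idl // => _.
  apply: contraTN isT => /(subsetP sDR).
  by rewrite inE dx ltnNge leq_addl andbF.
have x_n : x.1 = n :> nat by apply/eqP; rewrite eqn_leq xn -ltnS ltn_ord.
have yk : y.1 = k :> nat by move: xy; rewrite x_n; lia.
apply/imsetP/idP => [[z]|yS].
  rewrite inE => /andP[zS /eqP zk] xz.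
  by rewrite (_ : y = z) //; apply: cell_eq; rewrite ?zk // -xy2 xz.
exists y; first by rewrite inE yS yk eqxx.
by apply: cell_eq.
Qed.

(** Going back in time from [Y], [n.+1] uses of [matches_pred] rebuild [S] row by row at the
    bottom. *)
Lemma top_packed_reaches (R : realFieldType) l (S Y : arrayn n.+1 c l) :
    top_packed (val S) ->
  connect [rel B A : arrayn n.+1 c l | 0 < transition R A B] Y S.
Proof.
move=> pS; have card_val (A : arrayn n.+1 c l) : #|val A| = l by apply/eqP/(valP A).
(* Here [k] is the number of rows of [S] still to be built. *)
suff /(_ n.+1) : forall k, (k <= n.+1)%N -> forall Y : arrayn n.+1 c l,
    matches (n.+1 - k) (val Y) (val S) ->
    connect [rel B A : arrayn n.+1 c l | 0 < transition R A B] Y S.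
  by apply=> //; rewrite subnn; apply: matches0.
elim=> [_ Z|k IHk ltkn Z mZ].
  by rewrite subn0 => /matches_full/val_inj->.
have [||X [cX sX mX]] := matches_pred _ _ pS mZ; rewrite ?card_val //.
  by rewrite subSS leq_subr.
have cX' : #|X| == l by rewrite cX card_val.
apply: (@connect_trans _ _ (Sub X cX')).
  by apply: connect1; apply: transition_gt0; rewrite SubK.
by apply: IHk; rewrite ?(ltnW ltkn) // SubK; rewrite -subSn // subSS in mX.
Qed.

End Reachability.

(** * The board without rows, and the conclusion *)

Lemma arrayn0_eq (c l : nat) (A B : arrayn 0 c l) : A = B.
Proof. by apply/val_inj/setP; case; case. Qed.

(** The shift maps above live on [n.+1] rows. Without rows the only array is empty and stays put
    with probability 1. *)
Lemma weight_stationary0 (R : realFieldType) (c l : nat) (B : arrayn 0 c l) :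
  \sum_(A : arrayn 0 c l) (weight (val A))%:R * transition R A B =
  (weight (val B))%:R.
Proof.
rewrite (big_pred1 B) => [|A]; last by apply/esym/eqP/arrayn0_eq.
rewrite /transition ifT; last by apply/subsetP; case; case.
have -> : row_balls (val B) 0 = 0%N by apply: eq_card0; case; case.
by rewrite bin0 invr1 mulr1.
Qed.

Lemma exists_common_source (R : realFieldType) (r c l : nat) :
    (l <= r * c)%N ->
  exists S : arrayn r c l, forall Y,
    connect [rel B A : arrayn r c l | 0 < transition R A B] Y S.
Proof.
case: r => [|n] le_l.
  have c0 : #|(set0 : {set 'I_0 * 'I_c})| == l.
    by rewrite cards0; case: l le_l.
  by exists (Sub set0 c0) => Y; rewrite (arrayn0_eq Y (Sub set0 c0)).
have [S /eqP cS pS] := top_packed_exists le_l.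
by exists (Sub S cS) => Y; apply: top_packed_reaches; rewrite SubK.
Qed.

Theorem theorem4p2 (R : realFieldType) (r c l : nat) (hl : (l <= r * c)%N) :
  is_stationary (@transition r c R l) (@juggling_pi r c R l) /\
  (forall p : arrayn r c l -> R,
     is_stationary (@transition r c R l) p -> p =1 @juggling_pi r c R l).
Proof.
have [S S_source] := exists_common_source R hl.
(* The array [S] ensures that the sum has a term. *)
have Z_gt0 : (0 < normalization r c l)%N.
  rewrite /normalization (bigD1 S) //= ltn_addr //; exact: weight_gt0.
have pi_gt0 (A : arrayn r c l) : 0 < juggling_pi R A.
  by apply: mulr_gt0; rewrite ?invr_gt0 ltr0n ?weight_gt0.
have piP : is_stationary (@transition r c R l) (@juggling_pi r c R l).
  split; [split=> [A|]; first exact: ltW|move=> B].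
    by rewrite -mulr_sumr -natr_sum mulVf // pnatr_eq0 -lt0n.
  under eq_bigr do rewrite -mulrA.
  rewrite -mulr_sumr /juggling_pi; congr (_ * _).
  case: r hl B {S S_source Z_gt0 pi_gt0} => [|n] hl B; first exact: weight_stationary0.
  exact: weight_stationary.
split=> // p pP; apply: (stationary_unique _ pP piP pi_gt0 S_source).
exact: transition_ge0.
Qed.
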